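(* Let $n \ge 2$ and let $P$ be a symmetric alcoved polytope of type $B_n$ or $C_n$. Then $P$ has a generating set consisting of $2n$ vertices of $P$.
   Context: For a root system $\Phi$ in a real inner product space $V$, an alcoved polytope of type $t$ is a bounded set of the form $\bigcap_{a \in \Psi}\{x \in V : \langle a, x\rangle \le c_a\}$, where $\Psi$ is a subset of a root system $\Phi$ of type $t$ in $V$ and $c_a \in \mathbb{R}$. It is symmetric if it is invariant under the Weyl group of $\Phi$ (the group generated by the reflections in the hyperplanes orthogonal to the roots). A subset $\Sigma \subseteq V$ is a generating set of $P$ if $P$ is the smallest alcoved polytope (for $\Phi$) in $V$ containing $\Sigma$. (The number $2n$ is the Coxeter number of $B_n$ and $C_n$.) *)

(* Defs.v *)
From HB Require Import structures.
From mathcomp Require Import all_boot all_order all_algebra.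
From mathcomp Require Import sesquilinear.
From mathcomp Require Import boolp classical_sets cardinality reals.

Set Implicit Arguments.
Unset Strict Implicit.
Unset Printing Implicit Defensive.

Import Order.TTheory GRing.Theory Num.Theory.

Local Open Scope ring_scope.
Local Open Scope classical_set_scope.

Section Roots.
Variables (R : realType) (V : vectType R) (B : V -> V -> R).

Definition cartan (a b : V) : R := 2 * B a b / B b b.

Definition reflection (a x : V) : V := x - cartan x a *: a.

(* Reduced crystallographic root system spanning V. *)
Record is_root_system (Phi : set V) : Prop := IsRootSystem {
  root_finite : finite_set Phi;
  root_span : (<<finmap.enum_fset (fset_set Phi)>> = fullv)%VS;
  root_neq0 : ~ Phi 0;
  root_reduced : forall (a : V) (k : R),
    Phi a -> Phi (k *: a) -> k = 1 \/ k = - 1;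
  root_reflection : forall a b : V, Phi a -> Phi b -> Phi (reflection a b);
  root_integral : forall a b : V, Phi a -> Phi b -> cartan a b \is a Num.int
}.

(* Reflections are involutions, so closure under composition already yields the
   generated group. *)
Inductive weyl_group (Phi : set V) : (V -> V) -> Prop :=
| weyl_id : weyl_group Phi id
| weyl_reflection a : Phi a -> weyl_group Phi (reflection a)
| weyl_comp w1 w2 :
    weyl_group Phi w1 -> weyl_group Phi w2 -> weyl_group Phi (w1 \o w2).

Definition bounded_for (P : set V) : Prop :=
  exists M : R, forall x, P x -> Num.sqrt (B x x) <= M.

Definition alcoved_polytope (Phi P : set V) : Prop :=
  bounded_for P /\
  exists (Psi : set V) (c : V -> R),
    Psi `<=` Phi /\ P = [set x | forall a, Psi a -> B a x <= c a].

Definition weyl_symmetric (Phi P : set V) : Prop :=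
  forall w, weyl_group Phi w -> w @` P = P.

Definition generating_set (Phi P S : set V) : Prop :=
  [/\ alcoved_polytope Phi P, S `<=` P &
      forall Q, alcoved_polytope Phi Q -> S `<=` Q -> P `<=` Q].

(* A vertex is a zero-dimensional face: the unique maximizer over P of some
   linear functional. *)
Definition vertex (P : set V) (x : V) : Prop :=
  P x /\ exists u : V, forall y, P y -> y <> x -> B u y < B u x.

End Roots.

Section Types.
Variables (R : realType) (n : nat).

Definition std_dot (u v : 'rV[R]_n) : R := \sum_(i < n) u 0 i * v 0 i.

Definition D_roots : set 'rV[R]_n :=
  [set v | exists (i j : 'I_n) (s t : bool),
    i != j /\ v = (-1) ^+ s *: 'e_i + (-1) ^+ t *: 'e_j].

Definition std_B : set 'rV[R]_n :=
  [set v | exists (i : 'I_n) (s : bool), v = (-1) ^+ s *: 'e_i]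
  `|` D_roots.

Definition std_C : set 'rV[R]_n :=
  [set v | exists (i : 'I_n) (s : bool), v = (-1) ^+ s *: (2 *: 'e_i)]
  `|` D_roots.

(* Isomorphism of root systems: a linear bijection carrying one onto the other
   and preserving the Cartan integers (it need not be an isometry). *)
Definition root_system_iso (V : vectType R) (B : V -> V -> R)
    (Phi0 : set 'rV[R]_n) (Phi : set V) : Prop :=
  exists f : {linear 'rV[R]_n -> V},
    [/\ bijective f, f @` Phi0 = Phi &
        forall a b, Phi0 a -> Phi0 b ->
          cartan B (f a) (f b) = cartan std_dot a b].

Definition type_B (V : vectType R) (B : V -> V -> R) (Phi : set V) : Prop :=
  is_root_system B Phi /\ root_system_iso B std_B Phi.

Definition type_C (V : vectType R) (B : V -> V -> R) (Phi : set V) : Prop :=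
  is_root_system B Phi /\ root_system_iso B std_C Phi.

End Types.

(* Main.v *)
Require Import Defs.
From HB Require Import structures.
From mathcomp Require Import all_boot all_order all_algebra.
From mathcomp Require Import sesquilinear.
From mathcomp Require Import boolp classical_sets cardinality reals.
From mathcomp Require Import ring lra.

Set Implicit Arguments.
Unset Strict Implicit.
Unset Printing Implicit Defensive.

Import Order.TTheory GRing.Theory Num.Theory.

Local Open Scope ring_scope.
Local Open Scope classical_set_scope.

(* An isomorphism from the standard root system sends the canonical basis to
   orthogonal vectors e_i of equal length. With x_i := <e_i, x>, a symmetric
   alcoved polytope is {x | |x_i| <= a, |x_i| + |x_j| <= b for i != j}, where a
   and b are the values of its support function on the two kinds of roots (up to
   scaling); its invariance and subadditivity give a <= b <= 2 a. A point of the
   orbit of (a, b - a, ..., b - a) with large entry at i and signs s maximizes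
   the functionals s_i e_i and s_i e_i + s_j e_j, hence it is a vertex. Taking
   for each i the two sign vectors +-(-1, ..., -1, 1, ..., 1), the entry i being
   the first one after the sign change, every root attains its maximum over the
   polytope at one of the resulting 2n points. *)

Lemma eq_card_bijective (T T' : finType) : #|T| = #|T'| ->
  exists f : T -> T', bijective f.
Proof.
move=> eqT; exists (enum_val \o cast_ord eqT \o enum_rank).
apply: bij_comp (enum_rank_bij T); apply: bij_comp (enum_val_bij T') _.
by exists (cast_ord (esym eqT)); [exact: cast_ordK | exact: cast_ordKV].
Qed.

Lemma range_comp_bij (T U W : Type) (v : U -> W) (f : T -> U) :
  bijective f -> range (v \o f) = range v.
Proof.
move=> [g fK gK]; apply/seteqP; split=> [_ [x _ <-]|_ [y _ <-]].
  by exists (f x).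
by exists (g y) => //=; rewrite gK.
Qed.

Section GeneratingCriterion.
Variables (R : realType) (V : vectType R) (B : V -> V -> R).

Lemma generating_set_attained (Phi P S : set V) :
  alcoved_polytope B Phi P -> S `<=` P ->
  (forall a, Phi a -> exists2 v, S v & forall x, P x -> B a x <= B a v) ->
  generating_set B Phi P S.
Proof.
move=> alcP SP attained; split=> // Q [_ [Psi [d [PsiPhi ->]]]] SQ x Px a Psia.
have [v Sv max_v] := attained a (PsiPhi a Psia).
exact: le_trans (max_v x Px) (SQ v Sv a Psia).
Qed.

End GeneratingCriterion.

Section InnerProduct.
Variables (R : realType) (V : vectType R) (dot : {dot V for (@idfun R)}).
Implicit Types (a b u v x y : V) (P Phi : set V).

Lemma dotC x y : dot x y = dot y x.
Proof. by rewrite hermC expr0 mul1r. Qed.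

Lemma dot_self_eq0 x : (dot x x == 0) = (x == 0).
Proof.
have [->|x0] := eqVneq x 0; first by rewrite linear0l eqxx.
by rewrite gt_eqF // neq0_dnorm_gt0.
Qed.

Lemma dot_self_ge0 x : 0 <= dot x x.
Proof.
by have [->|x0] := eqVneq x 0; [rewrite linear0l | exact/ltW/neq0_dnorm_gt0].
Qed.

Lemma cartan_eq0 x a : (cartan dot x a == 0) = (dot x a == 0).
Proof.
rewrite /cartan !mulf_eq0 invr_eq0 pnatr_eq0 dot_self_eq0 /= orbC.
by have [->|] := eqVneq a 0; rewrite ?linear0r ?eqxx.
Qed.

Lemma reflectionD a x y :
  reflection dot a (x + y) = reflection dot a x + reflection dot a y.
Proof.
by rewrite /reflection /cartan linearDl mulrDr mulrDl scalerDl opprD addrACA.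
Qed.

Lemma reflectionZ (c : R) a x : c != 0 ->
  reflection dot (c *: a) x = reflection dot a x.
Proof.
move=> c0; have [->|a0] := eqVneq a 0; first by rewrite scaler0.
rewrite /reflection /cartan scalerA linearZl_LR !linearZr_LR /=.
congr (_ - _ *: _); field.
by rewrite c0 andbT dot_self_eq0.
Qed.

Lemma reflection_self a : reflection dot a a = - a.
Proof.
have [->|a0] := eqVneq a 0; first by rewrite /reflection scaler0 subrr oppr0.
rewrite /reflection /cartan mulfK ?dot_self_eq0 //.
by rewrite scaler_nat mulr2n opprD addNKr.
Qed.

Lemma reflection_orthogonal a x : dot x a = 0 -> reflection dot a x = x.
Proof.
by move=> xa; rewrite /reflection /cartan xa mulr0 mul0r scale0r subr0.
Qed.

Lemma reflection_swap a b : dot a a = dot b b -> reflection dot (a - b) a = b.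
Proof.
move=> ab; have [->|nab] := eqVneq a b.
  by rewrite /reflection subrr scaler0 subr0.
have two_dot : 2 * dot a (a - b) = dot (a - b) (a - b).
  by rewrite linearBl !linearBr /= (dotC b a) -ab; ring.
rewrite /reflection /cartan two_dot divff ?scale1r ?subKr //.
by rewrite dot_self_eq0 subr_eq0.
Qed.

Lemma dot_reflection a x y :
  dot (reflection dot a x) y = dot x (reflection dot a y).
Proof.
rewrite /reflection /cartan linearBl linearBr /= linearZl_LR linearZr_LR /=.
by rewrite (dotC a y); ring.
Qed.

Lemma weyl_symmetric_reflection Phi P a :
  weyl_symmetric dot Phi P -> Phi a -> reflection dot a @` P = P.
Proof. by move=> symP Phia; apply: symP; exact: weyl_reflection. Qed.

Lemma vertex_maximizer (J : finType) (F : J -> V) P v :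
  P v -> (forall j y, P y -> dot (F j) y <= dot (F j) v) ->
  (forall y, P y -> (forall j, dot (F j) y = dot (F j) v) -> y = v) ->
  vertex dot P v.
Proof.
move=> Pv max_v uniq_v; split=> //; exists (\sum_j F j) => y Py y_neq_v.
rewrite !linear_sumlz lt_neqAle ler_sum ?andbT => [|j _]; last exact: max_v.
apply/eqP => eq_sum; apply: y_neq_v; apply: uniq_v => // j.
have /leifP := leif_sum (fun j (_ : true) => leif_eq (max_v j y Py)).
by case: ifP => [/forallP/(_ j)/eqP//|_]; rewrite eq_sum ltxx.
Qed.

Definition support P u : R := sup [set dot u x | x in P].

Lemma support_reflection Phi P a u : weyl_symmetric dot Phi P -> Phi a ->
  support P (reflection dot a u) = support P u.
Proof.
move=> symP Phia; congr (sup _).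
rewrite -[in RHS](weyl_symmetric_reflection symP Phia) image_comp.
by apply: eq_imagel => x _; rewrite dot_reflection.
Qed.

Section BoundedSupport.
Variable P : set V.
Hypotheses (P_bounded : bounded_for dot P) (P_neq0 : P !=set0).

Lemma dot_le_support u x : P x -> dot u x <= support P u.
Proof.
move=> Px; apply: ub_le_sup; last by exists x.
have [M PM] := P_bounded; exists (dot u u + M ^+ 2) => _ [y /PM yM <-].
have sqr_y : dot y y <= M ^+ 2.
  rewrite -[leLHS]sqr_sqrtr ?dot_self_ge0 // lerXn2r ?nnegrE ?sqrtr_ge0 //.
  by rewrite (le_trans _ yM) ?sqrtr_ge0.
have two_dot : 2 * dot u y <= dot u u + dot y y.
  have := dot_self_ge0 (u - y).
  by rewrite linearBl !linearBr /= (dotC y u); lra.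
have := dot_self_ge0 u; have := sqr_ge0 M; lra.
Qed.

Lemma support_le u M : (forall x, P x -> dot u x <= M) -> support P u <= M.
Proof.
move=> uM; apply: ge_sup => [|_ [x Px <-]]; last exact: uM.
by have [x Px] := P_neq0; exists (dot u x), x.
Qed.

Lemma supportD_le u v : support P (u + v) <= support P u + support P v.
Proof.
by apply: support_le => x Px; rewrite linearDl lerD ?dot_le_support.
Qed.

Lemma supportZ c u : 0 < c -> support P (c *: u) = c * support P u.
Proof.
move=> c0; apply/eqP; rewrite eq_le; apply/andP; split.
  by apply: support_le => x Px; rewrite linearZl_LR ler_pM2l // dot_le_support.
rewrite mulrC -ler_pdivlMr //; apply: support_le => x Px.
rewrite ler_pdivlMr // mulrC; have := dot_le_support (c *: u) Px.
by rewrite linearZl_LR.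
Qed.

Lemma alcoved_polytope_mem Phi x : alcoved_polytope dot Phi P ->
  (forall a, Phi a -> dot a x <= support P a) -> P x.
Proof.
move=> [_ [Psi [c [PsiPhi PE]]]] x_le; rewrite PE => a Psia.
apply: le_trans (x_le a (PsiPhi a Psia)) _; apply: support_le => y.
by rewrite PE; apply.
Qed.

End BoundedSupport.
End InnerProduct.

Section StepCoordinates.
Variables (R : realFieldType) (n : nat) (a b : R).
Implicit Types (i j : 'I_n) (s t : bool).

(* The signs are chosen so that, for all [i < j], the four points with large
   entry at [i] or [j] realize all four sign patterns at [(i, j)]. *)
Definition step_coord i s j : R :=
  (-1) ^+ (s (+) (j < i)%N) * (if j == i then a else b - a).

Lemma step_coord_diag i s : (-1) ^+ s * step_coord i s i = a.
Proof. by rewrite /step_coord ltnn eqxx addbF signrMK. Qed.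

Lemma step_coord_pair_attained i j s t : i != j -> exists k u,
  (-1) ^+ s * step_coord k u i + (-1) ^+ t * step_coord k u j = b.
Proof.
wlog lt_ij : i j s t / (i < j)%N.
  move=> wlog_ij ij; have [|lt_ji|/val_inj/eqP] := ltngtP i j.
  - by move=> lt_ij; apply: wlog_ij.
  - have [|k [u pair_b]] := wlog_ij j i t s lt_ji; first by rewrite eq_sym.
    by exists k, u; rewrite addrC.
  - by rewrite (negbTE ij).
move=> ij; have [<-|s_neq_t] := eqVneq s t.
  exists i, s; rewrite step_coord_diag /step_coord ltnNge ltnW // addbF.
  by rewrite eq_sym (negbTE ij) signrMK addrC subrK.
exists j, t; rewrite step_coord_diag /step_coord lt_ij (negbTE ij) addbT.
by rewrite (_ : ~~ t = s) ?signrMK ?subrK //; case: s t s_neq_t => -[].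
Qed.

Lemma step_coord_inj i j s t : a != 0 ->
  step_coord i s =1 step_coord j t -> (i, s) = (j, t).
Proof.
move=> a0; wlog le_ij : i j s t / (i <= j)%N.
  move=> wlog_ij eq_coord; have [/wlog_ij|ji] := leqP i j; first exact.
  by apply/esym/wlog_ij => [|l]; [exact: ltnW | rewrite eq_coord].
move=> eq_coord; move: (eq_coord i) (eq_coord j).
rewrite /step_coord !ltnn !eqxx !addbF (eq_sym j i).
have [<- + _|ij] := eqVneq i j.
  by rewrite ltnn addbF => /(mulIf a0)/signr_inj->.
have lt_ij : (i < j)%N by rewrite ltn_neqAle ij.
rewrite lt_ij ltnNge le_ij addbF addbT => eq_i eq_j; case/eqP: a0.
by move: eq_i eq_j; case: s {eq_coord}; case: t; rewrite ?expr0 ?expr1 /=; lra.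
Qed.

Section Norm.
Hypotheses (ab : a <= b) (ba : b <= a + a).

Lemma norm_step_coord i s j :
  `|step_coord i s j| = if j == i then a else b - a.
Proof.
by rewrite /step_coord normrMsign ger0_norm //; move: ab ba; case: ifP; lra.
Qed.

Lemma norm_step_coord_le i s j : `|step_coord i s j| <= a.
Proof. by rewrite norm_step_coord; move: ab ba; case: ifP; lra. Qed.

Lemma norm_step_coord_pair_le i s j k : j != k ->
  `|step_coord i s j| + `|step_coord i s k| <= b.
Proof.
rewrite !norm_step_coord; have [->|_] := eqVneq j i; move: ab ba.
  by rewrite eq_sym => + + /negbTE->; lra.
by case: ifP; lra.
Qed.

End Norm.
End StepCoordinates.

Section SignedVectors.
Variables (R : pzRingType) (n : nat) (V : lmodType R).
Implicit Types (e : 'I_n -> V) (i j : 'I_n) (s t : bool).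

Definition signed e s i : V := (-1) ^+ s *: e i.

(* [c = 1] gives B_n and [c = 2] gives C_n. *)
Variant BC_root (c : R) e : V -> Prop :=
| AxisRoot i s : BC_root c e (c *: signed e s i)
| PairRoot i j s t : i != j -> BC_root c e (signed e s i + signed e t j).

End SignedVectors.

Section LinearImage.
Variables (R : pzRingType) (n : nat) (V W : lmodType R) (f : {linear V -> W}).
Implicit Types (e : 'I_n -> V).

Lemma linear_signed e s i : f (signed e s i) = signed (f \o e) s i.
Proof. by rewrite /signed linearZ. Qed.

Lemma image_BC_root c e : f @` BC_root c e = BC_root c (f \o e).
Proof.
apply/seteqP; split=> [_ [_ [i s|i j s t ij] <-]|_ [i s|i j s t ij]].
- by rewrite linearZ linear_signed; exact: AxisRoot.
- by rewrite linearD !linear_signed; exact: PairRoot.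
- exists (c *: signed e s i); first exact: AxisRoot.
  by rewrite linearZ linear_signed.
- exists (signed e s i + signed e t j); first exact: PairRoot.
  by rewrite linearD !linear_signed.
Qed.

End LinearImage.

Section Frame.
Variables (R : realType) (n : nat) (V : vectType R).
Variable dot : {dot V for (@idfun R)}.

Record orthogonal_frame (k : R) (e : 'I_n -> V) : Prop := OrthogonalFrame {
  frame_scale_gt0 : 0 < k;
  frame_dot : forall i j, dot (e i) (e j) = k *+ (i == j);
  frame_separates : forall x y, (forall i, dot (e i) x = dot (e i) y) -> x = y
}.

Variables (k : R) (e : 'I_n -> V).
Hypothesis e_frame : orthogonal_frame k e.
Implicit Types (i j : 'I_n) (s t : bool) (x y : V).

Lemma dot_signed s i x : dot (signed e s i) x = (-1) ^+ s * dot (e i) x.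
Proof. by rewrite linearZl_LR. Qed.

Lemma dot_signed_le s i x : dot (signed e s i) x <= `|dot (e i) x|.
Proof. by rewrite dot_signed -(normrMsign s) ler_norm. Qed.

Lemma dot_signed_pair_le s t i j x :
  dot (signed e s i + signed e t j) x <= `|dot (e i) x| + `|dot (e j) x|.
Proof. by rewrite linearDl lerD ?dot_signed_le. Qed.

Lemma norm_dot_signed i x :
  `|dot (e i) x| = dot (signed e (dot (e i) x < 0)%R i) x.
Proof. by rewrite dot_signed normrEsign. Qed.

Lemma frame_orthogonal i j : i != j -> dot (e i) (e j) = 0.
Proof. by move=> /negbTE ij; rewrite (frame_dot e_frame) ij. Qed.

Definition frame_point (y : 'I_n -> R) : V := k^-1 *: \sum_i y i *: e i.

Lemma dot_frame_point (y : 'I_n -> R) i : dot (e i) (frame_point y) = y i.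
Proof.
rewrite linearZr_LR linear_sumr (bigD1 i) //= big1 => [|j ji].
  rewrite addr0 linearZr_LR /= (frame_dot e_frame) eqxx mulrCA mulVf ?mulr1 //.
  by rewrite gt_eqF // (frame_scale_gt0 e_frame).
by rewrite linearZr_LR /= frame_orthogonal ?mulr0 // eq_sym.
Qed.

Definition BC_polytope (a b : R) : set V :=
  [set x | (forall i, `|dot (e i) x| <= a) /\
    forall i j, i != j -> `|dot (e i) x| + `|dot (e j) x| <= b].

Lemma BC_polytope0 (b : R) : 0 <= b -> BC_polytope 0 b = [set 0].
Proof.
move=> b0; apply/seteqP; split=> [x [x_le0 _]|_ -> /=].
  apply: (frame_separates e_frame) => i; rewrite linear0r.
  by apply/eqP; rewrite -normr_le0.
by split=> [i|i j _]; rewrite !linear0r normr0 ?addr0.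
Qed.

Section StepPoints.
Variables a b : R.
Hypotheses (ab : a <= b) (ba : b <= a + a).

Definition step_point i s : V := frame_point (step_coord a b i s).

Lemma BC_polytope_step_point i s : BC_polytope a b (step_point i s).
Proof.
split=> [j|j l jl]; rewrite !dot_frame_point.
  exact: norm_step_coord_le.
exact: norm_step_coord_pair_le.
Qed.

Lemma step_point_vertex i s :
  vertex dot (BC_polytope a b) (step_point i s).
Proof.
pose sgn j := s (+) (j < i)%N.
have sgn_i : sgn i = s by rewrite /sgn ltnn addbF.
(* For [j = i] this is [2 *: signed e s i]. *)
pose tight j := signed e s i + signed e (sgn j) j.
have tight_point j :
    dot (tight j) (step_point i s) = a + (if j == i then a else b - a).
  rewrite linearDl /= !dot_signed !dot_frame_point step_coord_diag.
  by rewrite /step_coord signrMK.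
apply: (vertex_maximizer (F := tight)) => [|j y [y_a y_b]|y _ tight_y].
- exact: BC_polytope_step_point.
- rewrite tight_point; apply: le_trans (dot_signed_pair_le _ _ _ _ _) _.
  case: eqVneq => [->|ji]; first exact: lerD.
  by rewrite [leRHS]addrC subrK; apply: y_b; rewrite eq_sym.
have signed_y : dot (signed e s i) y = dot (signed e s i) (step_point i s).
  by move: (tight_y i); rewrite /tight sgn_i !linearDl /=; lra.
apply: (frame_separates e_frame) => j; move: (tight_y j).
rewrite /tight !linearDl /= signed_y !dot_signed => /addrI.
exact: (can_inj (signrMK _)).
Qed.

Lemma step_point_inj i j s t : a != 0 ->
  step_point i s = step_point j t -> (i, s) = (j, t).
Proof.
move=> a0 eq_point; apply: (step_coord_inj (b := b) a0) => l.
by have := congr1 (dot (e l)) eq_point; rewrite !dot_frame_point.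
Qed.

Lemma step_point_axis_max i s x : BC_polytope a b x ->
  dot (signed e s i) x <= dot (signed e s i) (step_point i s).
Proof.
move=> [x_a _]; rewrite [leRHS]dot_signed dot_frame_point step_coord_diag.
exact: le_trans (dot_signed_le _ _ _) (x_a i).
Qed.

Lemma step_point_pair_max i j s t : i != j ->
  exists l u, forall x, BC_polytope a b x ->
    dot (signed e s i + signed e t j) x
      <= dot (signed e s i + signed e t j) (step_point l u).
Proof.
move=> ij; have [l [u pair_b]] := step_coord_pair_attained a b s t ij.
exists l, u => x [_ x_b]; apply: le_trans (dot_signed_pair_le _ _ _ _ _) _.
by rewrite linearDl /= !dot_signed !dot_frame_point pair_b; apply: x_b.
Qed.

Lemma step_points_generating c : 0 < c ->
  alcoved_polytope dot (BC_root c e) (BC_polytope a b) ->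
  generating_set dot (BC_root c e) (BC_polytope a b)
    (range (fun p => step_point p.1 p.2)).
Proof.
move=> c0 alc; apply: generating_set_attained => //.
  by move=> _ [[i s] _ <-]; apply: BC_polytope_step_point.
move=> _ [i s|i j s t ij].
  exists (step_point i s) => [|x Px]; first by exists (i, s).
  rewrite [leLHS]linearZl_LR [leRHS]linearZl_LR /= ler_pM2l //.
  exact: step_point_axis_max.
have [l [u max_lu]] := step_point_pair_max s t ij.
by exists (step_point l u) => //; exists (l, u).
Qed.

Lemma BC_polytope_generators c : 0 < c ->
  alcoved_polytope dot (BC_root c e) (BC_polytope a b) ->
  exists v : 'I_n * bool -> V,
    [/\ BC_polytope a b <> [set 0] -> injective v,
        forall p, vertex dot (BC_polytope a b) (v p) &
        generating_set dot (BC_root c e) (BC_polytope a b) (range v)].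
Proof.
move=> c0 alc; exists (fun p => step_point p.1 p.2).
split=> [nontrivial|[i s]|].
- move=> [i s] [j t] /step_point_inj; apply; apply/eqP => a0; apply: nontrivial.
  by rewrite a0 BC_polytope0 // -a0.
- exact: step_point_vertex.
- exact: step_points_generating.
Qed.

End StepPoints.
End Frame.

Section SymmetricPolytope.
Variables (R : realType) (n : nat) (V : vectType R).
Variable dot : {dot V for (@idfun R)}.
Variables (k c : R) (e : 'I_n -> V).
Hypotheses (e_frame : orthogonal_frame dot k e) (c_gt0 : 0 < c).
Variable P : set V.
Hypothesis P_alcoved : alcoved_polytope dot (BC_root c e) P.
Hypothesis P_neq0 : P !=set0.
Hypothesis P_sym : weyl_symmetric dot (BC_root c e) P.
Implicit Types (i j : 'I_n) (s t : bool) (u x : V).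

Local Notation h := (support dot P).

Let P_bounded : bounded_for dot P := P_alcoved.1.

Lemma support_sign i s u : dot u (e i) = 0 ->
  h (signed e s i + u) = h (e i + u).
Proof.
move=> ui; case: s; last by rewrite /signed scale1r.
rewrite -[RHS](support_reflection _ P_sym (AxisRoot c e i false)).
rewrite /signed scale1r reflectionZ ?gt_eqF // reflectionD reflection_self.
by rewrite reflection_orthogonal // scaleN1r.
Qed.

Lemma support_exchange i j u : dot u (e i) = 0 -> dot u (e j) = 0 ->
  h (e i + u) = h (e j + u).
Proof.
move=> ui uj; have [->//|ij] := eqVneq i j.
rewrite -[LHS](support_reflection _ P_sym (PairRoot c e false true ij)).
rewrite /signed scale1r scaleN1r reflectionD reflection_swap; last first.
  by rewrite !(frame_dot e_frame) !eqxx.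
by rewrite reflection_orthogonal // linearBr /= ui uj subrr.
Qed.

Lemma support_axis i j s : h (signed e s i) = h (e j).
Proof.
rewrite -[signed _ _ _]addr0 support_sign ?linear0l //.
by rewrite (@support_exchange i j) ?linear0l // addr0.
Qed.

Lemma support_pair i j l m s t : i != j -> l != m ->
  h (signed e s i + signed e t j) = h (e l + e m).
Proof.
move=> ij lm; have orth := frame_orthogonal e_frame.
rewrite support_sign; last by rewrite dot_signed orth ?mulr0 // eq_sym.
rewrite addrC support_sign ?orth // addrC.
have [jl|jl] := eqVneq j l.
  by rewrite (@support_exchange i m) ?orth ?jl // 1?addrC // -jl eq_sym.
rewrite (@support_exchange i l) ?orth // 1?eq_sym // addrC.
by rewrite (@support_exchange j m) ?orth // 1?eq_sym // addrC.
Qed.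

Section RootOrbits.
Variables i0 i1 : 'I_n.
Hypothesis i01 : i0 != i1.

Local Notation a := (h (e i0)).
Local Notation b := (h (e i0 + e i1)).

Lemma support_axis_le_pair : a <= b.
Proof.
have two_e : 2 *: e i0 = (e i0 + e i1) + (signed e false i0 + signed e true i1).
  by rewrite /signed scale1r scaleN1r addrACA subrr addr0 scaler_nat.
have := supportD_le P_bounded P_neq0 (e i0 + e i1)
          (signed e false i0 + signed e true i1).
by rewrite -two_e supportZ // (support_pair _ _ i01 i01); lra.
Qed.

Lemma support_pair_le_axis : b <= a + a.
Proof.
rewrite -[X in _ <= _ + X](support_axis i1 i0 false) /signed scale1r.
exact: supportD_le.
Qed.

Lemma symmetric_polytope_supportE : P = BC_polytope dot e a b.
Proof.
apply/seteqP; split=> [x Px|x [x_a x_b]].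
  split=> [i|i j ij]; rewrite !norm_dot_signed -?linearDl.
    by rewrite -(support_axis i i0 (dot (e i) x < 0)%R) dot_le_support.
  rewrite -(support_pair (dot (e i) x < 0)%R (dot (e j) x < 0)%R ij i01).
  exact: dot_le_support.
apply: (alcoved_polytope_mem P_neq0 P_alcoved) => _ [i s|i j s t ij].
  rewrite supportZ // linearZl_LR ler_pM2l // (support_axis i i0).
  exact: le_trans (dot_signed_le _ _ _ _ _) (x_a i).
rewrite (support_pair _ _ ij i01).
exact: le_trans (dot_signed_pair_le _ _ _ _ _ _ _) (x_b i j ij).
Qed.

End RootOrbits.

Lemma symmetric_BC_polytope : (1 < n)%N -> exists a b,
  [/\ a <= b, b <= a + a & P = BC_polytope dot e a b].
Proof.
move=> n1; pose i0 : 'I_n := Ordinal (ltnW n1); pose i1 : 'I_n := Ordinal n1.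
have i01 : i0 != i1 by [].
exists (h (e i0)), (h (e i0 + e i1)); split.
- exact: support_axis_le_pair.
- exact: support_pair_le_axis.
- exact: symmetric_polytope_supportE.
Qed.

End SymmetricPolytope.

Section StandardRoots.
Variables (R : realType) (n : nat).
Implicit Types (x y : 'rV[R]_n) (i j : 'I_n).

Definition std_frame i : 'rV[R]_n := 'e_i.

Lemma std_BC_root (c : R) :
  [set v | exists (i : 'I_n) (s : bool), v = (-1) ^+ s *: (c *: 'e_i)]
    `|` @D_roots R n = BC_root c std_frame.
Proof.
apply/seteqP; split.
  move=> _ [[i [s ->]]|[i [j [s [t [ij ->]]]]]]; last exact: PairRoot.
  by rewrite scalerA mulrC -scalerA; exact: AxisRoot.
move=> _ [i s|i j s t ij]; last by right; exists i, j, s, t.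
by left; exists i, s; rewrite !scalerA mulrC.
Qed.

Lemma std_C_BC_root : @std_C R n = BC_root 2 std_frame.
Proof. exact: std_BC_root. Qed.

Lemma std_B_BC_root : @std_B R n = BC_root 1 std_frame.
Proof.
rewrite -std_BC_root; congr (_ `|` _); apply/seteqP.
by split=> v [i [s ->]]; exists i, s; rewrite scale1r.
Qed.

Lemma std_dotDl x y z : std_dot (x + y) z = std_dot x z + std_dot y z.
Proof. by rewrite -big_split; apply: eq_bigr => i _; rewrite mxE mulrDl. Qed.

Lemma std_dotZl (c : R) x y : std_dot (c *: x) y = c * std_dot x y.
Proof. by rewrite big_distrr; apply: eq_bigr => i _; rewrite mxE /= mulrA. Qed.

Lemma std_dot_delta i y : std_dot 'e_i y = y 0 i.
Proof.
rewrite /std_dot (bigD1 i) //= big1 ?addr0 ?mxE ?eqxx ?mul1r // => j ji.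
by rewrite !mxE /= (negbTE ji) mul0r.
Qed.

End StandardRoots.

Section RootSystemIso.
Variables (R : realType) (n : nat) (V : vectType R).
Variable dot : {dot V for (@idfun R)}.
Variables (c : R) (f : {linear 'rV[R]_n -> V}).
Implicit Types (a b : 'rV[R]_n) (i j : 'I_n).

Local Notation std := (@std_frame R n).

Hypothesis c_gt0 : 0 < c.
Hypothesis f_cartan : forall a b,
  BC_root c std a -> BC_root c std b ->
  cartan dot (f a) (f b) = cartan (@std_dot R n) a b.

Lemma root_iso_orthogonal a b :
  BC_root c std a -> BC_root c std b ->
  std_dot a b = 0 -> dot (f a) (f b) = 0.
Proof.
move=> roota rootb ab; apply/eqP; rewrite -cartan_eq0 f_cartan //.
by rewrite /cartan ab mulr0 mul0r.
Qed.

Lemma root_iso_delta_orthogonal i j : i != j -> dot (f 'e_i) (f 'e_j) = 0.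
Proof.
move=> ij; have := root_iso_orthogonal (AxisRoot c std i false)
                     (AxisRoot c std j false).
rewrite /signed /std_frame !scale1r std_dotZl std_dot_delta !mxE.
rewrite (negbTE ij) !mulr0 => /(_ erefl)/eqP.
by rewrite !linearZ /= linearZl_LR /= !mulf_eq0 gt_eqF //= => /eqP.
Qed.

Lemma root_iso_delta_norm i j : dot (f 'e_i) (f 'e_i) = dot (f 'e_j) (f 'e_j).
Proof.
have [->//|ij] := eqVneq i j.
have := root_iso_orthogonal (PairRoot c std false false ij)
          (PairRoot c std false true ij).
rewrite /signed /std_frame !scale1r scaleN1r std_dotDl !std_dot_delta.
rewrite !mxE !eqxx (eq_sym j i) (negbTE ij) subr0 add0r subrr => /(_ erefl)/eqP.
rewrite linearD linearB linearDl !linearBr /= (dotC dot (f 'e_j)).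
by rewrite (root_iso_delta_orthogonal ij) subr0 sub0r subr_eq0 => /eqP.
Qed.

Lemma root_iso_frame i0 : bijective f ->
  orthogonal_frame dot (dot (f 'e_i0) (f 'e_i0)) (f \o std).
Proof.
move=> [g fK gK]; have f_inj := can_inj fK.
have k_gt0 : 0 < dot (f 'e_i0) (f 'e_i0).
  apply: neq0_dnorm_gt0; rewrite raddf_eq0 //.
  by apply/eqP => /rowP/(_ i0)/eqP; rewrite !mxE !eqxx oner_eq0.
have f_dot i j : dot (f 'e_i) (f 'e_j) = dot (f 'e_i0) (f 'e_i0) *+ (i == j).
  have [->|ij] := eqVneq i j; first exact: root_iso_delta_norm.
  exact: root_iso_delta_orthogonal.
have f_coord i y : dot (f 'e_i) (f y) = dot (f 'e_i0) (f 'e_i0) * y 0 i.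
  rewrite {1}[y]row_sum_delta linear_sum linear_sumr (bigD1 i) //=.
  rewrite big1 => [|j ji].
    by rewrite linearZ linearZr_LR /= f_dot eqxx addr0 mulrC.
  by rewrite linearZ linearZr_LR /= f_dot eq_sym (negbTE ji) mulr0.
split=> // x y xy; rewrite -(gK x) -(gK y); congr (f _); apply/rowP => i.
apply: (mulfI (lt0r_neq0 k_gt0)); rewrite -!f_coord !gK; exact: xy.
Qed.

End RootSystemIso.

Lemma type_BC_frame (R : realType) (n : nat) (V : vectType R)
    (dot : {dot V for (@idfun R)}) (Phi : set V) :
  (0 < n)%N -> type_B n dot Phi \/ type_C n dot Phi ->
  exists c k (e : 'I_n -> V),
    [/\ 0 < c, orthogonal_frame dot k e & Phi = BC_root c e].
Proof.
move=> n0 typePhi.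
have [c c0 [f [f_bij <- f_cartan]]] :
    exists2 c : R, 0 < c & root_system_iso dot (BC_root c (@std_frame R n)) Phi.
  case: typePhi => -[_]; first by rewrite std_B_BC_root; exists 1.
  by rewrite std_C_BC_root; exists 2.
exists c, (dot (f 'e_(Ordinal n0)) (f 'e_(Ordinal n0))), (f \o @std_frame R n).
by split=> //; [exact: (root_iso_frame c0 f_cartan) | exact: image_BC_root].
Qed.

Theorem theorem4p5 (R : realType) (n : nat) (hn : (2 <= n)%N)
    (V : vectType R) (dot : {dot V for (@idfun R)}) (Phi P : set V)
    (hPhi : type_B n dot Phi \/ type_C n dot Phi)
    (hP : alcoved_polytope dot Phi P) (P_neq0 : P !=set0)
    (hsym : weyl_symmetric dot Phi P) :
  exists v : 'I_(2 * n) -> V,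
    [/\ P <> [set 0] -> injective v,
        forall i, vertex dot P (v i) &
        generating_set dot Phi P (range v)].
Proof.
move: hP hsym.
have [c [k [e [c_gt0 e_frame ->]]]] := type_BC_frame (ltnW hn) hPhi => hP hsym.
move: (hP).
have [a [b [ab ba ->]]] :=
  symmetric_BC_polytope e_frame c_gt0 hP P_neq0 hsym hn.
move=> /(BC_polytope_generators e_frame ab ba c_gt0)[v [v_inj v_vertex v_gen]].
have [|r r_bij] := @eq_card_bijective 'I_(2 * n) ('I_n * bool)%type.
  by rewrite card_prod !card_ord card_bool mulnC.
exists (v \o r); split=> [/v_inj v_injective|i|].
- exact: inj_comp v_injective (bij_inj r_bij).
- exact: v_vertex.
- by rewrite range_comp_bij.
Qed.
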